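(* Let $K, L \subseteq \mathbb{R}^2$ be $1$-symmetric convex bodies. Then $$d_{BM}(K, L) \leq \sqrt{2}.$$ Moreover, equality holds if and only if one of the convex bodies $K, L$ is a square (let it be $L$) and the second one (then called $K$) satisfies for every $x \in \mathbb{R}^2$ the condition $$\|x \|_K \, \| x \|_{\varphi(K^\circ)} \geq \| x\|^2,$$ where $\varphi \colon \mathbb{R}^2 \to \mathbb{R}^2$ is a rotation by $45^\circ$ (about the origin).
   Context: A convex body in $\mathbb{R}^n$ is a compact convex set with non-empty interior. A convex body $K\subseteq\mathbb{R}^n$ is $1$-symmetric if for every $x=(x_1,\ldots,x_n)\in K$, every choice of signs $\sigma\in\{-1,1\}^n$ and every permutation $\pi$ of $\{1,\ldots,n\}$, one has $(\sigma_1x_{\pi(1)},\ldots,\sigma_nx_{\pi(n)})\in K$. $\|\cdot\|$ is the Euclidean norm and $\|\cdot\|_K$ is the norm on $\mathbb{R}^n$ whose unit ball is the origin symmetric convex body $K$. The polar of $X\subseteq\mathbb{R}^n$ is $X^\circ=\{y\in\mathbb{R}^n : \langle x,y\rangle\le 1\text{ for all }x\in X\}$. The direction of the rotation $\varphi$ does not matter, since planar $1$-symmetric convex bodies are invariant under rotation by $90^\circ$. The Banach-Mazur distance of convex bodies $K,L\subseteq\mathbb{R}^n$ is $d_{BM}(K,L)=\inf\{\rho>0 : K+u\subseteq T(L+v)\subseteq\rho(K+u)\}$, where the infimum is over all invertible linear operators $T:\mathbb{R}^n\to\mathbb{R}^n$ and vectors $u,v\in\mathbb{R}^n$ (it is attained,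 and for origin symmetric $K,L$ one may take $u=v=0$). *)

(* Defs.v *)
(* Points of R^n are column vectors ['cV[R]_n] over a [realType].  The library
   topology on ['cV[R]_n] is the product topology, i.e. the Euclidean one, but
   the library norm [`|x|] is the sup norm; hence [enorm] below. *)
From HB Require Import structures.
From mathcomp Require Import all_boot all_order all_algebra all_fingroup.
From mathcomp Require Import all_classical all_reals all_analysis.

Set Implicit Arguments.
Unset Strict Implicit.
Unset Printing Implicit Defensive.

Import Order.TTheory GRing.Theory Num.Theory.
Import numFieldNormedType.Exports.

Local Open Scope classical_set_scope.
Local Open Scope ring_scope.

Definition dotv (R : realType) (n : nat) (x y : 'cV[R]_n) : R :=
  \sum_(i < n) x i 0 * y i 0.

Definition enorm (R : realType) (n : nat) (x : 'cV[R]_n) : R :=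
  Num.sqrt (dotv x x).

Definition convex_body (R : realType) (n : nat) (K : set 'cV[R]_n) : Prop :=
  [/\ compact K, convex_set K & K° !=set0].

(* The sign [sigma_i] is [(-1) ^+ s i]. *)
Definition one_symmetric (R : realType) (n : nat) (K : set 'cV[R]_n) : Prop :=
  forall x : 'cV[R]_n, K x ->
  forall (s : 'I_n -> bool) (p : 'S_n),
    K (\col_(i < n) ((-1) ^+ s i * x (p i) 0)).

(* Minkowski functional: the norm with unit ball [K] when [K] is an origin
   symmetric convex body.  As a real infimum it is 0 when no [t] qualifies,
   which does not happen if 0 is interior to [K]. *)
Definition gauge (R : realType) (n : nat) (K : set 'cV[R]_n) (x : 'cV[R]_n)
    : R :=
  inf [set t : R | 0 < t /\ [set t *: y | y in K] x].

Definition polar (R : realType) (n : nat) (X : set 'cV[R]_n) : set 'cV[R]_n :=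
  [set y | forall x, X x -> dotv x y <= 1].

Definition translate (R : realType) (n : nat) (K : set 'cV[R]_n)
    (u : 'cV[R]_n) : set 'cV[R]_n :=
  [set x + u | x in K].

(* The infimum is taken in [\bar R], so that the infimum of an empty set would
   be [+oo] rather than the junk value 0 of the real [inf]. *)
Definition banach_mazur (R : realType) (n : nat) (K L : set 'cV[R]_n)
    : \bar R :=
  ereal_inf [set rho%:E | rho in [set rho : R | 0 < rho /\
    exists (T : 'M[R]_n) (u v : 'cV[R]_n),
      [/\ T \in unitmx,
          translate K u `<=` [set T *m y | y in translate L v] &
          [set T *m y | y in translate L v] `<=`
            [set rho *: x | x in translate K u]]]].

(* A square is an image of [[-1, 1]^2] under a similarity. *)
Definition is_square (R : realType) (L : set 'cV[R]_2) : Prop :=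
  exists (r : R) (U : 'M[R]_2) (v : 'cV[R]_2),
    [/\ 0 < r, U^T *m U = 1%:M &
        L = [set r *: (U *m y) + v | y in
              [set y : 'cV[R]_2 | forall i, `|y i 0| <= 1]]].

Definition rotation_mx (R : realType) (a : R) : 'M[R]_2 :=
  \matrix_(i < 2, j < 2)
    if i == j then cos a else if i == 0 then - sin a else sin a.

Definition rot45 (R : realType) (x : 'cV[R]_2) : 'cV[R]_2 :=
  rotation_mx (pi / 4) *m x.

Definition rotated_polar_condition (R : realType) (K : set 'cV[R]_2) : Prop :=
  forall x : 'cV[R]_2,
    gauge K x * gauge [set rot45 y | y in polar K] x >= enorm x ^+ 2.

(* Main.v *)
Require Import Defs.
From mathcomp Require Import all_boot all_order all_algebra all_fingroup.
From mathcomp Require Import all_classical all_reals all_analysis.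
From mathcomp Require Import ring lra.

Import Order.TTheory GRing.Theory Num.Theory.
Import numFieldNormedType.Exports.

Local Open Scope classical_set_scope.
Local Open Scope ring_scope.

(** Let [J] be the rotation by 90 degrees and [B_1] the unit ball of the
    l1-norm, a square.

    Upper bound. Let [s] be the largest abscissa in a 1-symmetric body and
    [(d, d)] its diagonal boundary point. Averaging over the symmetries
    squeezes the body between two octagons that depend only on [s] and [d]
    ([between_octagons_exists]), and [d <= s <= 2 * d]. Comparing the inner
    octagon of one body with the outer octagon of the other gives inclusions
    both ways whose scaling factors multiply to [octagon_coupling s d s' d' ^+
    2 / (s * d * (s' * d'))]. The regular octagon is the ratio [s / d = sqrt
    2]; when the two bodies lie on the same side of it, this product is at
    most [sqrt 2] ([octagon_coupling_sqr_bound_sameside]). Otherwise, turning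
    one body by 45 degrees, which changes [(s, d)] into a multiple of [(2 * d,
    s)], brings them to the same side. The bound is strict as soon as [d < s <
    2 * d] and [d' < s' < 2 * d'], and the extreme ratios belong to squares
    only ([between_octagons_square]).

    Distance to a square. Let [K <= M B_1 <= rho K] with [det M > 0]. Since
    [K] and [B_1] are invariant under [J], the conjugate of [M] by [J]
    satisfies the same inclusions. Averaging [M] with this conjugate, and
    likewise their inverses, projects [M] and [M^-1] on conformal matrices. If
    [alpha] is the first column of the conformal part of [M], the conformal
    part of [M^-1] is [|alpha|^2 / det M >= 1] times the inverse of that of
    [M], so the similarity [alpha B_1] is also squeezed between [K] and [rho
    K]. Hence the optimal parallelograms may be taken to be squares; for a
    square with vertices [+-x], [+-J x], the best [rho] is [sqrt 2 * gauge K x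
    * gauge (rot45 (polar K)) x / |x|^2]. The condition on [K] says exactly
    that this is at least [sqrt 2] for every [x] ([banach_mazur_square_ge],
    [banach_mazur_square_lt]). *)

(** * Coordinates in the plane *)

Definition pt {R : realType} (a b : R) : 'cV[R]_2 :=
  \col_i (if i == 0 then a else b).

Definition mx2 {R : realType} (a b c d : R) : 'M[R]_2 :=
  \matrix_(i, j) (if i == 0 then (if j == 0 then a else b)
                  else (if j == 0 then c else d)).

Lemma ptE (R : realType) (x : 'cV[R]_2) : x = pt (x 0 0) (x 1 0).
Proof.
apply/matrixP => i j; rewrite !mxE !ord1.
by case: i => [[|[|i]] hi] //=; congr (x _ _); apply/val_inj.
Qed.

Lemma ptD (R : realType) (a b c d : R) : pt a b + pt c d = pt (a + c) (b + d).
Proof. by apply/matrixP => i j; rewrite !mxE; case: ifP. Qed.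

Lemma ptZ (R : realType) (k a b : R) : k *: pt a b = pt (k * a) (k * b).
Proof. by apply/matrixP => i j; rewrite !mxE; case: ifP. Qed.

Lemma ptN (R : realType) (a b : R) : - pt a b = pt (- a) (- b).
Proof. by apply/matrixP => i j; rewrite !mxE; case: ifP. Qed.

Lemma pt_inj (R : realType) (a b c d : R) :
  pt a b = pt c d -> a = c /\ b = d.
Proof.
by move=> e; split; [have := congr1 (fun x : 'cV_2 => x 0 0) e|
  have := congr1 (fun x : 'cV_2 => x 1 0) e]; rewrite !mxE.
Qed.

Lemma mx2_mul (R : realType) (a b c d p q : R) :
  mx2 a b c d *m pt p q = pt (a * p + b * q) (c * p + d * q).
Proof.
by apply/matrixP => i j; rewrite !mxE !big_ord_recl big_ord0 !mxE /= addr0;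
  case: ifP.
Qed.

Lemma mx2E (R : realType) (M : 'M[R]_2) :
  M = mx2 (M 0 0) (M 0 1) (M 1 0) (M 1 1).
Proof.
apply/matrixP => i j; rewrite !mxE.
by case: i => [[|[|i]] hi] //=; case: j => [[|[|j]] hj] //=;
  congr (M _ _); apply/val_inj.
Qed.

Lemma det_mx2_neq0 (R : realType) (a b c d : R) :
  (mx2 a b c d \in unitmx) = (a * d - b * c != 0).
Proof.
rewrite unitmxE unitfE (expand_det_row _ 0) !big_ord_recl big_ord0 /cofactor.
by rewrite !det_mx11 !mxE /= addr0 expr0 expr1 mul1r mulN1r mulrN.
Qed.

Lemma dotv_pt (R : realType) (a b c d : R) :
  dotv (pt a b) (pt c d) = a * c + b * d.
Proof. by rewrite /dotv !big_ord_recl big_ord0 !mxE /= addr0. Qed.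

Lemma enorm_pt_sqr (R : realType) (a b : R) :
  enorm (pt a b) ^+ 2 = a ^+ 2 + b ^+ 2.
Proof.
by rewrite /enorm sqr_sqrtr dotv_pt -!expr2// addr_ge0 ?sqr_ge0.
Qed.

Lemma normB_normD_le (R : realType) (x y m : R) :
  `|x| <= m -> `|y| <= m -> `|x - y| + `|x + y| <= 2 * m.
Proof.
rewrite !ler_norml => /andP[? ?] /andP[? ?].
by case: (ger0P (x - y)); case: (ger0P (x + y)); lra.
Qed.

(** * Symmetric convex bodies *)

Lemma one_symmetric_flip (R : realType) (K : set 'cV[R]_2) (a b : R) :
  one_symmetric K -> K (pt a b) -> K (pt (- a) b).
Proof.
move=> sK Kab; have := sK _ Kab (fun i => i == 0) 1%g.
congr K; apply/matrixP => i j; rewrite !mxE perm1.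
by case: ifP => _; rewrite ?expr1 ?mulN1r ?expr0 ?mul1r.
Qed.

Lemma one_symmetric_swap (R : realType) (K : set 'cV[R]_2) (a b : R) :
  one_symmetric K -> K (pt a b) -> K (pt b a).
Proof.
move=> sK Kab; have := sK _ Kab (fun=> false) (tperm 0 1).
congr K; apply/matrixP => i j; rewrite !mxE expr0 mul1r.
by case: i => [[|[|i]] hi] //=; rewrite permE /=.
Qed.

Lemma one_symmetric_flipr (R : realType) (K : set 'cV[R]_2) (a b : R) :
  one_symmetric K -> K (pt a b) -> K (pt a (- b)).
Proof.
by move=> sK /(one_symmetric_swap _ _ _ _ sK) /(one_symmetric_flip _ _ _ _ sK)
  /(one_symmetric_swap _ _ _ _ sK).
Qed.

Lemma one_symmetric_rot90 (R : realType) (K : set 'cV[R]_2) (a b : R) :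
  one_symmetric K -> K (pt a b) -> K (pt (- b) a).
Proof.
by move=> sK /(one_symmetric_swap _ _ _ _ sK) /(one_symmetric_flip _ _ _ _ sK).
Qed.

Lemma one_symmetricN (R : realType) (K : set 'cV[R]_2) (x : 'cV[R]_2) :
  one_symmetric K -> K x -> K (- x).
Proof.
rewrite [x]ptE ptN => sK /(one_symmetric_flip _ _ _ _ sK).
exact: one_symmetric_flipr.
Qed.

(** Reduces membership to the first quadrant, where absolute values disappear. *)
Lemma one_symmetric_abs (R : realType) (K : set 'cV[R]_2) (a b : R) :
  one_symmetric K -> K (pt `|a| `|b|) -> K (pt a b).
Proof.
move=> sK; case: (ger0P a) => _; case: (ger0P b) => _ //.
- by move=> /(one_symmetric_flipr _ _ _ _ sK); rewrite opprK.
- by move=> /(one_symmetric_flip _ _ _ _ sK); rewrite opprK.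
- by move=> /(one_symmetricN _ _ _ sK); rewrite ptN !opprK.
Qed.

Lemma convex_body_conv (R : realType) (n : nat) (K : set 'cV[R]_n)
    (x y : 'cV[R]_n) (t : R) :
  convex_body K -> K x -> K y -> 0 <= t <= 1 -> K (t *: x + (1 - t) *: y).
Proof.
move=> [_ cK _] Kx Ky /andP[t0 t1].
by have := cK x y (Itv01 t0 t1); rewrite !inE; apply.
Qed.

Lemma convex_body_mid (R : realType) (n : nat) (K : set 'cV[R]_n)
    (x y : 'cV[R]_n) :
  convex_body K -> K x -> K y -> K (2^-1 *: (x + y)).
Proof.
move=> bK Kx Ky; have := @convex_body_conv R n K x y 2^-1 bK Kx Ky.
rewrite scalerDr; have -> : 1 - 2^-1 = 2^-1 :> R by lra.
by apply; lra.
Qed.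

(** After changing signs of [x] and [y] the coefficients are nonnegative, and
    the remaining weight [1 - l - m] goes to the centre of [K]. *)
Lemma symmetric_body_comb (R : realType) (K : set 'cV[R]_2)
    (x y : 'cV[R]_2) (l m : R) :
  convex_body K -> one_symmetric K -> K x -> K y -> `|l| + `|m| <= 1 ->
  K (l *: x + m *: y).
Proof.
move=> bK sK.
wlog l0 : l x / 0 <= l.
  move=> wl Kx Ky lm; have [l0|/ltW l0] := leP 0 l; first exact: wl.
  have := wl (- l) (- x); rewrite scalerN scaleNr opprK normrN; apply => //.
    by rewrite oppr_ge0.
  exact: one_symmetricN.
wlog m0 : m y / 0 <= m.
  move=> wl Kx Ky lm; have [m0|/ltW m0] := leP 0 m; first exact: wl.
  have := wl (- m) (- y); rewrite scalerN scaleNr opprK normrN; apply => //.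
    by rewrite oppr_ge0.
  exact: one_symmetricN.
move=> Kx Ky; rewrite !ger0_norm// => lm.
have K0 : K 0.
  have := convex_body_mid _ _ _ _ _ bK Kx (one_symmetricN _ _ _ sK Kx).
  by rewrite subrr scaler0.
have [s0|sn0] := eqVneq (l + m) 0.
  have -> : l = 0 by lra.
  have -> : m = 0 by lra.
  by rewrite !scale0r addr0.
have Kz : K ((l / (l + m)) *: x + (1 - l / (l + m)) *: y).
  apply: convex_body_conv => //.
  have lm0 : 0 < l + m by rewrite lt_def sn0 addr_ge0.
  apply/andP; split; first by rewrite divr_ge0// ltW.
  by rewrite ler_pdivrMr// mul1r lerDl.
have := @convex_body_conv R 2 K _ 0 (l + m) bK Kz K0.
rewrite scaler0 addr0 scalerDr !scalerA.
have -> : (l + m) * (l / (l + m)) = l by field.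
have -> : (l + m) * (1 - l / (l + m)) = m by field.
by apply; rewrite addr_ge0.
Qed.

(** * Octagons around a 1-symmetric body *)

(** The two hypotheses of the last clause describe, cleared of denominators,
    the convex hull of the points [(+-s, 0)], [(0, +-s)], [(+-d, +-d)]: each
    is the facet inequality on one side of the diagonals, and implies the
    other there because [s <= 2 * d]. *)
Definition between_octagons {R : realType} (K : set 'cV[R]_2) (s d : R) :=
  [/\ 0 < d, d <= s, s <= 2 * d,
   forall x y, K (pt x y) -> [/\ `|x| <= s, `|y| <= s & `|x| + `|y| <= 2 * d] &
   forall x y, d * `|x| + (s - d) * `|y| <= s * d ->
     d * `|y| + (s - d) * `|x| <= s * d -> K (pt x y)].

Lemma compact_linear_max (R : realType) (K : set 'cV[R]_2) (a b : R) :
  convex_body K ->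
  exists x y, K (pt x y) /\
    forall x' y', K (pt x' y') -> a * x' + b * y' <= a * x + b * y.
Proof.
move=> [cK _ iK].
have [x xK xm] : exists2 x, x \in K &
    forall t, t \in K -> a * t 0 0 + b * t 1 0 <= a * x 0 0 + b * x 1 0.
  pose f (x : 'cV[R]_2) := a * x 0 0 + b * x 1 0.
  apply: (@compact_EVT_max _ R f) => //.
    by case: iK => z /interior_subset; exists z.
  apply: continuous_subspaceT => z.
  have cc i := @coord_continuous R 2 1 i 0 z.
  exact: cvgD (cvgM (cvg_cst a) (cc 0)) (cvgM (cvg_cst b) (cc 1)).
exists (x 0 0), (x 1 0); rewrite -ptE; split; first by rewrite -inE.
by move=> x' y'; rewrite -inE => /xm; rewrite !mxE.
Qed.

(** [s] and [2 * d] are the maxima of [x] and of [x + y] on [K]. Averaging a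
    maximiser with its mirror image moves it to the axis, respectively to the
    diagonal; the other bounds follow by symmetry, and [0 < d] because a body
    with an interior point has positive width. *)
Lemma between_octagons_exists (R : realType) (K : set 'cV[R]_2) :
  convex_body K -> one_symmetric K -> exists s d, between_octagons K s d.
Proof.
move=> bK sK.
have flip := fun a b => one_symmetric_flip R K a b sK.
have flipr := fun a b => one_symmetric_flipr R K a b sK.
have swap := fun a b => one_symmetric_swap R K a b sK.
have [s [y0 [Ks ms]]] := compact_linear_max R K 1 0 bK.
have [d1 [d2 [Kd md]]] := compact_linear_max R K 1 1 bK.
have {}ms x y : K (pt x y) -> x <= s by move=> /ms; lra.
have {}md x y : K (pt x y) -> x + y <= d1 + d2 by move=> /md; lra.
have {y0}Ks : K (pt s 0).
  have := convex_body_mid _ _ _ _ _ bK Ks (flipr _ _ Ks).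
  by rewrite ptD ptZ; congr (K (pt _ _)); lra.
set d := (d1 + d2) / 2.
have {}Kd : K (pt d d).
  have := convex_body_mid _ _ _ _ _ bK Kd (swap _ _ Kd).
  by rewrite ptD ptZ; congr (K (pt _ _)); rewrite /d; lra.
have {}md x y : K (pt x y) -> x + y <= 2 * d by move=> /md; rewrite /d; lra.
have out x y : K (pt x y) -> [/\ `|x| <= s, `|y| <= s & `|x| + `|y| <= 2 * d].
  move=> Kxy.
  have h1 := ms _ _ Kxy; have h2 := ms _ _ (flip _ _ Kxy).
  have h3 := ms _ _ (swap _ _ Kxy); have h4 := ms _ _ (flip _ _ (swap _ _ Kxy)).
  have g1 := md _ _ Kxy; have g2 := md _ _ (flip _ _ Kxy).
  have g3 := md _ _ (flipr _ _ Kxy).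
  have g4 := md _ _ (flip _ _ (flipr _ _ Kxy)).
  by split; case: (ger0P x); case: (ger0P y); lra.
have ds : d <= s by exact: ms Kd.
have sd : s <= 2 * d by have := md _ _ Ks; lra.
have d0 : 0 < d.
  case: bK => _ _ [z]; rewrite /interior => /nbhs_ballP[e /= e0 be].
  suff : K (pt (z 0 0 + e / 2) (z 1 0)).
    have /out[zs _ _] : K (pt (z 0 0) (z 1 0)).
      by rewrite -ptE; apply/be/ballxx.
    move=> /out[zs' _ _]; move: zs zs'; rewrite !ler_norml.
    by move=> /andP[? ?] /andP[? ?]; lra.
  apply: be; rewrite /ball /= /mx_ball; split => // i j; rewrite /ball /= !mxE.
  rewrite !ord1; have := e0; case: i => [[|[|i]] hi] //= e0'.
    rewrite (_ : Ordinal hi = 0); last exact/val_inj.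
    by rewrite opprD addrA subrr add0r normrN gtr0_norm; lra.
  rewrite (_ : Ordinal hi = 1); last exact/val_inj.
  by rewrite subrr normr0.
exists s, d; split => // x y h1 h2; apply: one_symmetric_abs => //.
have : 0 <= `|x| by []. have : 0 <= `|y| by [].
move: h1 h2; move: `|x| `|y| => {}x {}y.
have in1 a b : 0 <= b -> b <= a -> d * a + (s - d) * b <= s * d -> K (pt a b).
  move=> b0 ba h; have s0 : 0 < s by lra.
  have sn : s != 0 by rewrite gt_eqF.
  have dn : d != 0 by rewrite gt_eqF.
  have := symmetric_body_comb R K _ _ ((a - b) / s) (b / d) bK sK Ks Kd.
  rewrite !ptZ ptD.
  have -> : (a - b) / s * s + b / d * d = a.
    by field; rewrite ?sn ?dn.
  have -> : (a - b) / s * 0 + b / d * d = b.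
    by field; rewrite ?sn ?dn.
  have c1 : 0 <= (a - b) / s by apply: divr_ge0; lra.
  have c2 : 0 <= b / d by apply: divr_ge0; lra.
  apply; rewrite !ger0_norm//.
  have -> : (a - b) / s + b / d = (d * a + (s - d) * b) / (s * d).
    by field; rewrite ?sn ?dn.
  by rewrite ler_pdivrMr ?mul1r// mulr_gt0.
move=> h1 h2 y0 x0; have [yx|/ltW xy] := leP y x; first exact: in1.
exact/swap/in1.
Qed.

(** * Elementary properties of the Banach-Mazur distance *)

Lemma banach_mazur_le (R : realType) (n : nat) (K L : set 'cV[R]_n)
    (T : 'M[R]_n) (v : 'cV[R]_n) (rho : R) :
  0 < rho -> T \in unitmx ->
  (forall x, K x -> exists2 y, L y & x = T *m (y + v)) ->
  (forall y, L y -> exists2 x, K x & T *m (y + v) = rho *: x) ->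
  (banach_mazur K L <= rho%:E)%E.
Proof.
move=> rho0 uT KL LK; apply: ereal_inf_lbound; exists rho => //; split=> //.
exists T, 0, v; split=> //.
  move=> _ [x /KL[y Ly ->] <-]; rewrite addr0.
  by exists (y + v) => //; exists y.
move=> _ [_ [y /LK[x Kx xy] <-] <-]; rewrite xy; exists x => //.
by exists x => //; rewrite addr0.
Qed.

(** If [T] takes [L] to the middle of [K <= T L <= rho K], then [rho *: T^-1]
    takes [K] to the middle of [L <= rho T^-1 K <= rho L]. *)
Lemma banach_mazur_leC (R : realType) (n : nat) (K L : set 'cV[R]_n) :
  (banach_mazur K L <= banach_mazur L K)%E.
Proof.
apply: le_ereal_inf_tmp => _ [rho [rho0 [T [u [v [uT LK KL]]]]] <-].
apply: ereal_inf_lbound; exists rho => //; split=> //.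
have ur : rho \is a GRing.unit by rewrite unitfE gt_eqF.
exists (rho *: invmx T), v, u; split.
- by rewrite unitmxZ// unitmx_inv.
- move=> x Kx; have [|z Lz e] := KL (T *m x); first by exists x.
  by exists z => //; rewrite -scalemxAl scalemxAr e mulKmx.
- move=> _ [z Lz <-]; have [x Kx <-] := LK _ Lz.
  by exists x => //; rewrite -scalemxAl mulKmx.
Qed.

Lemma banach_mazurC (R : realType) (n : nat) (K L : set 'cV[R]_n) :
  banach_mazur K L = banach_mazur L K.
Proof. by apply/eqP; rewrite eq_le !banach_mazur_leC. Qed.

(** * Comparing octagons *)

(** [octagon_coupling s d s' d' / (s' * d')] is the gauge of the inner [(s',
    d')]-octagon at the vertex [(s, 2 * d - s)] of the outer [(s, d)]-octagon,
    where it is largest. The expression is symmetric in the two pairs, so that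
    it serves both inclusions. *)
Definition octagon_coupling {R : realType} (s d s' d' : R) : R :=
  2 * s * d' + 2 * d * s' - 2 * d * d' - s * s'.

Lemma octagon_coupling_gt0 (R : realType) (s d s' d' : R) :
  0 < d -> d <= s -> 0 < d' -> d' <= s' -> s' <= 2 * d' ->
  0 < octagon_coupling s d s' d'.
Proof.
move=> d0 ds d'0 ds' sd'.
have -> : octagon_coupling s d s' d' =
    d * d' + ((2 * d' - s') * (s - d) + (s' - d') * d).
  by rewrite /octagon_coupling; ring.
by apply: ltr_pwDl; [exact: mulr_gt0|apply: addr_ge0; apply: mulr_ge0; lra].
Qed.

(** The facet inequality of the inner octagon of [L] is a combination, with
    the nonnegative weights [2 * d' - s'] and [s' - d'], of the two bounds
    [|x| <= s] and [|x| + |y| <= 2 * d] that hold on [K]. *)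
Lemma between_octagons_sub (R : realType) (K L : set 'cV[R]_2)
    (s d s' d' : R) :
  between_octagons K s d -> between_octagons L s' d' -> forall x, K x ->
  exists2 y, L y & x = (octagon_coupling s d s' d' / (s' * d')) *: y.
Proof.
move=> [d0 ds sd outK _] [d'0 ds' sd' _ inL] x.
have := octagon_coupling_gt0 R s d s' d' d0 ds d'0 ds' sd'.
set N := octagon_coupling _ _ _ _ => N0.
have s'0 : 0 < s' by lra.
have t0 : 0 < N / (s' * d') by rewrite divr_gt0 ?mulr_gt0.
have Nt : s' * d' = N / (N / (s' * d')) by field; rewrite !gt_eqF.
move: t0 Nt; set t := N / _ => t0 Nt.
have bnd p q : `|p| <= s -> `|p| + `|q| <= 2 * d ->
    d' * `|t^-1 * p| + (s' - d') * `|t^-1 * q| <= s' * d'.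
  move=> ps pq; rewrite !normrM gtr0_norm ?invr_gt0// Nt.
  rewrite mulrCA (mulrCA (s' - d')) -mulrDr [leRHS]mulrC ler_pM2l ?invr_gt0//.
  have -> : d' * `|p| + (s' - d') * `|q| =
    (2 * d' - s') * `|p| + (s' - d') * (`|p| + `|q|) by ring.
  have -> : N = (2 * d' - s') * s + (s' - d') * (2 * d).
    by rewrite /N /octagon_coupling; ring.
  by apply: lerD; apply: ler_wpM2l => //; lra.
rewrite [x]ptE => /outK[h1 h2 h3].
exists (t^-1 *: pt (x 0 0) (x 1 0)); last first.
  by rewrite scalerA divff ?scale1r// gt_eqF.
by rewrite ptZ; apply: inL; apply: bnd => //; rewrite addrC.
Qed.

Lemma banach_mazur_octagons (R : realType) (K L : set 'cV[R]_2)
    (T : 'M[R]_2) (s d s' d' : R) :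
  T \in unitmx -> between_octagons K s d ->
  between_octagons [set T *m y | y in L] s' d' ->
  (banach_mazur K L <=
     (octagon_coupling s d s' d' ^+ 2 / (s * d * (s' * d')))%:E)%E.
Proof.
move=> uT bK bL; have [d0 ds sd _ _] := bK; have [d'0 ds' sd' _ _] := bL.
have N0 := octagon_coupling_gt0 R s d s' d' d0 ds d'0 ds' sd'.
have s0 : 0 < s by lra.
have s'0 : 0 < s' by lra.
have subK := between_octagons_sub R _ _ _ _ _ _ bK bL.
have subL := between_octagons_sub R _ _ _ _ _ _ bL bK.
have Nc : octagon_coupling s' d' s d = octagon_coupling s d s' d'.
  by rewrite /octagon_coupling; ring.
rewrite {}Nc in subL; move: N0 subK subL.
set N := octagon_coupling _ _ _ _ => N0 subK subL.
apply: (banach_mazur_le _ _ _ _ ((N / (s' * d')) *: T) 0).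
- by rewrite divr_gt0 ?exprn_gt0 ?mulr_gt0.
- by rewrite unitmxZ// unitfE gt_eqF// divr_gt0 ?mulr_gt0.
- move=> x /subK[_ [y Ly <-] ->]; exists y => //.
  by rewrite addr0 scalemxAl.
- move=> y Ly; have [|x Kx e] := subL (T *m y); first by exists y.
  exists x => //; rewrite addr0 -scalemxAl e scalerA; congr (_ *: _).
  by field; rewrite !gt_eqF.
Qed.

(** The matrix is [sqrt 2] times the rotation by 45 degrees, which exchanges
    the roles of axes and diagonals. *)
Lemma between_octagons_rot (R : realType) (K : set 'cV[R]_2) (s d : R) :
  between_octagons K s d ->
  between_octagons [set mx2 1 (-1) 1 1 *m y | y in K] (2 * d) s.
Proof.
move=> [d0 ds sd out inn]; split; [lra|lra|lra| |].
  move=> p q [x Kx]; rewrite [x]ptE mx2_mul => /pt_inj[<- <-].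
  move: Kx; rewrite [x in K x]ptE !mul1r mulN1r => /out[].
  move: (x 0 0) (x 1 0) => {}x y hx hy hxy; split.
  - exact: le_trans (ler_normB _ _) hxy.
  - exact: le_trans (ler_normD _ _) hxy.
  - exact: normB_normD_le.
move=> p q h1 h2; exists (pt ((p + q) / 2) ((q - p) / 2)); last first.
  by rewrite mx2_mul; congr pt; lra.
(* Up to order, the absolute values of the two coordinates of the preimage
   are those of half the sum and half the difference of [|p|] and [|q|]. *)
have key a b : 0 <= a -> 0 <= b -> s * a + (2 * d - s) * b <= 2 * d * s ->
    s * b + (2 * d - s) * a <= 2 * d * s ->
  d * `|(a + b) / 2| + (s - d) * `|(b - a) / 2| <= s * d /\
  d * `|(b - a) / 2| + (s - d) * `|(a + b) / 2| <= s * d.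
  move=> a0 b0 g1 g2.
  rewrite (@ger0_norm _ ((a + b) / 2)); last lra.
  have ha : 0 <= (2 * d - s) * a by rewrite mulr_ge0//; lra.
  have hb : 0 <= (2 * d - s) * b by rewrite mulr_ge0//; lra.
  by case: (ger0P ((b - a) / 2)) => h; split; lra.
have hp : 0 <= `|p| by []. have hq : 0 <= `|q| by [].
have [k1 k2] := key _ _ hp hq h1 h2.
have nh u v : u = - v -> `|u / 2| = `|v / 2| by move=> ->; rewrite mulNr normrN.
have sw : (`|(p + q) / 2| = `|(`|p| + `|q|) / 2| /\
           `|(q - p) / 2| = `|(`|q| - `|p|) / 2|) \/
          (`|(p + q) / 2| = `|(`|q| - `|p|) / 2| /\
           `|(q - p) / 2| = `|(`|p| + `|q|) / 2|).
  case: (ger0P p) => _; case: (ger0P q) => _; [by left|right|right|left]; split;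
    by [apply: nh; ring|congr (`|_ / 2|); ring].
by apply: inn; case: sw => -[-> ->].
Qed.

(** * The bound by the square root of 2 *)

(** With [C = 2 * d - s], [D = 2 * d' - s'] and [k = 2 - q], where [q] is the
    square root of 2, the coupling is [2 * d * d' - C * D] and the hypotheses
    say [0 <= C <= k * d] and [0 <= D <= k * d']. The difference of the two
    sides is then a combination of [(k * d - C) * (k * d' - D)] and [C * D]
    with nonnegative coefficients; it vanishes only if [C * D = 0]. *)
Lemma octagon_coupling_sqr_bound (R : realType) (q s d s' d' : R) :
  0 < q -> q ^+ 2 = 2 -> 0 < d -> 0 < d' -> s <= 2 * d -> s' <= 2 * d' ->
  q * d <= s -> q * d' <= s' ->
  octagon_coupling s d s' d' ^+ 2 <= q * (s * d * (s' * d')) /\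
  (s < 2 * d -> s' < 2 * d' ->
   octagon_coupling s d s' d' ^+ 2 < q * (s * d * (s' * d'))).
Proof.
move=> q0 q2 d0 d'0 sd sd' qs qs'.
have q1 : 1 < q by nra.
have q32 : q < 2 by nra.
pose C := 2 * d - s; pose D := 2 * d' - s'; pose k := 2 - q.
have id : q * (s * d * (s' * d')) = octagon_coupling s d s' d' ^+ 2 +
    (q * (2 + q) * (d * d') * ((k * d - C) * (k * d' - D)) +
     C * D * (k * (d * d') - C * D)).
  have -> : s = 2 * d - C by rewrite /C; ring.
  have -> : s' = 2 * d' - D by rewrite /D; ring.
  rewrite /octagon_coupling /k.
  have q3 : q ^+ 3 = 2 * q by rewrite exprS q2 mulrC.
  have q4 : q ^+ 4 = 4 by rewrite (exprM q 2 2) q2; ring.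
  ring: q2 q3 q4.
have C0 : 0 <= C by rewrite /C; lra.
have D0 : 0 <= D by rewrite /D; lra.
have Ck : C <= k * d by rewrite /C /k mulrBl; lra.
have Dk : D <= k * d' by rewrite /D /k mulrBl; lra.
have t1 : 0 <= q * (2 + q) * (d * d') * ((k * d - C) * (k * d' - D)).
  by rewrite !mulr_ge0//; lra.
have t2 : 0 < k * (d * d') - C * D.
  have : C * D <= k * d * (k * d') by exact: ler_pM.
  have : k * d * (k * d') < k * (d * d').
    have -> : k * d * (k * d') = k * (k * (d * d')) by ring.
    rewrite gtr_pMl ?mulr_gt0//; rewrite /k; lra.
  by lra.
rewrite id lerDl ltrDl; split.
  by rewrite addr_ge0// mulr_ge0 ?mulr_ge0// ltW.
move=> lt1 lt2; rewrite ltr_wpDl// !mulr_gt0//; rewrite /C /D; lra.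
Qed.

(** The substitution of [(2 * d, s)] for [(s, d)] in both bodies exchanges the
    two sides of [s = q * d] and multiplies both members of the inequality by
    4. *)
Lemma octagon_coupling_sqr_bound_sameside (R : realType) (q s d s' d' : R) :
  0 < q -> q ^+ 2 = 2 -> 0 < d -> 0 < d' -> d <= s -> d' <= s' ->
  s <= 2 * d -> s' <= 2 * d' ->
  (q * d <= s /\ q * d' <= s') \/ (s <= q * d /\ s' <= q * d') ->
  octagon_coupling s d s' d' ^+ 2 <= q * (s * d * (s' * d')) /\
  (d < s < 2 * d -> d' < s' < 2 * d' ->
   octagon_coupling s d s' d' ^+ 2 < q * (s * d * (s' * d'))).
Proof.
move=> q0 q2 d0 d'0 ds ds' sd sd' [] [h h'].
  have [le lt] :=
    octagon_coupling_sqr_bound R q s d s' d' q0 q2 d0 d'0 sd sd' h h'.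
  by split => // /andP[_ ?] /andP[_ ?]; exact: lt.
have qh x y : x <= q * y -> q * x <= 2 * y.
  by move=> xy; rewrite -q2 expr2 -mulrA ler_pM2l.
have s0 : 0 < s by lra.
have s'0 : 0 < s' by lra.
have r1 : 2 * d <= 2 * s by lra.
have r2 : 2 * d' <= 2 * s' by lra.
have [] := octagon_coupling_sqr_bound R q (2 * d) s (2 * d') s' q0 q2 s0 s'0
  r1 r2 (qh _ _ h) (qh _ _ h').
have -> : octagon_coupling (2 * d) s (2 * d') s' =
    2 * octagon_coupling s d s' d'.
  by rewrite /octagon_coupling; ring.
have -> : q * (2 * d * s * (2 * d' * s')) = 2 ^+ 2 * (q * (s * d * (s' * d'))).
  by ring.
have p4 : 0 < 2 ^+ 2 :> R by rewrite exprn_gt0.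
rewrite exprMn (ler_pM2l p4) (ltr_pM2l p4) => le lt; split=> //.
by move=> /andP[? _] /andP[? _]; apply: lt; rewrite ltr_pM2l.
Qed.

(** If the bodies are on opposite sides of the regular octagon, [L] is first
    turned by 45 degrees. *)
Lemma banach_mazur_octagons_le (R : realType) (K L : set 'cV[R]_2)
    (s d s' d' : R) :
  between_octagons K s d -> between_octagons L s' d' ->
  exists rho, [/\ (banach_mazur K L <= rho%:E)%E, rho <= Num.sqrt 2 &
    d < s < 2 * d -> d' < s' < 2 * d' -> rho < Num.sqrt 2].
Proof.
move=> bK bL; have [d0 ds sd _ _] := bK; have [d'0 ds' sd' _ _] := bL.
have q0 : 0 < Num.sqrt 2 :> R by rewrite sqrtr_gt0.
have q2 : Num.sqrt 2 ^+ 2 = 2 :> R by rewrite sqr_sqrtr.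
move: (Num.sqrt 2) q0 q2 => q q0 q2.
have s0 : 0 < s by lra.
have s'0 : 0 < s' by lra.
pose same (a b a' b' : R) :=
  (q * b <= a /\ q * b' <= a') \/ (a <= q * b /\ a' <= q * b').
have main T a b : T \in unitmx -> between_octagons [set T *m y | y in L] a b ->
    same s d a b -> (d' < s' < 2 * d' -> b < a < 2 * b) ->
    exists rho, [/\ (banach_mazur K L <= rho%:E)%E, rho <= q &
      d < s < 2 * d -> d' < s' < 2 * d' -> rho < q].
  move=> uT bTL sm im; have [b0 ba ab _ _] := bTL.
  have a0 : 0 < a by lra.
  have p0 : 0 < s * d * (a * b) by rewrite !mulr_gt0.
  have [le lt] := octagon_coupling_sqr_bound_sameside R q s d a b q0 q2 d0 b0
    ds ba sd ab sm.
  exists (octagon_coupling s d a b ^+ 2 / (s * d * (a * b))); split.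
  - exact: banach_mazur_octagons uT bK bTL.
  - by rewrite ler_pdivrMr.
  - by move=> h /im h'; rewrite ltr_pdivrMr// lt.
have bL1 : between_octagons [set 1%:M *m y | y in L] s' d'.
  by under eq_imagel => y _ do rewrite mul1mx; rewrite image_id.
have id sm := main 1%:M s' d' (unitmx1 _ _) bL1 sm (fun h => h).
have uR : mx2 1 (-1) 1 1 \in @unitmx R 2.
  by rewrite det_mx2_neq0 mulN1r opprK mulr1 (_ : 1 + 1 = 2%:R) ?pnatr_eq0.
have rot sm : _ := main _ (2 * d') s' uR (between_octagons_rot _ _ _ _ bL) sm.
have h2 x y : x <= q * y -> q * x <= 2 * y.
  by move=> xy; rewrite -q2 expr2 -mulrA ler_pM2l.
have h3 x y : q * y <= x -> 2 * y <= q * x.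
  by move=> xy; rewrite -q2 expr2 -mulrA ler_pM2l.
have [qs|/ltW qs] := leP (q * d) s; have [qs'|/ltW qs'] := leP (q * d') s'.
- by apply: id; left.
- by apply: rot; [left; split => //; exact: h2|move=> /andP[? ?]; lra].
- by apply: rot; [right; split => //; exact: h3|move=> /andP[? ?]; lra].
- by apply: id; right.
Qed.

(** For [s = d] both octagons are the square with sides parallel to the axes,
    for [s = 2 * d] the square with vertices on the axes. *)
Lemma between_octagons_square (R : realType) (K : set 'cV[R]_2) (s d : R) :
  between_octagons K s d -> ~~ (d < s < 2 * d) -> is_square K.
Proof.
move=> [d0 ds sd out inn].
have s0 : 0 < s by lra.
rewrite negb_and -!leNgt => /orP[sd'|ds'].
  have {ds sd'}e : d = s by lra.
  exists s, 1%:M, 0; split=> //; first by rewrite trmx1 mul1mx.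
  apply/seteqP; split=> [x|_ [y ys <-]].
    rewrite [x]ptE => /out[h1 h2 _]; exists (s^-1 *: pt (x 0 0) (x 1 0)).
      move=> i; rewrite !mxE normrM gtr0_norm ?invr_gt0// mulrC.
      by rewrite ler_pdivrMr// mul1r; case: ifP.
    by rewrite mul1mx addr0 scalerA divff ?scale1r// gt_eqF.
  rewrite mul1mx addr0 [y]ptE ptZ; apply: inn; rewrite e subrr mul0r addr0;
  by rewrite ler_pM2l// normrM gtr0_norm// -[leRHS]mulr1 ler_pM2l.
have {sd ds'}e : s = 2 * d by lra.
have q0 : 0 < Num.sqrt 2 :> R by rewrite sqrtr_gt0.
have q2 : Num.sqrt 2 ^+ 2 = 2 :> R by rewrite sqr_sqrtr.
move: (Num.sqrt 2) q0 q2 => q q0 q2.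
have qh : q * q^-1 = 1 by rewrite divff// gt_eqF.
move: q^-1 qh => h qh.
have hh : h * h = 2^-1.
  have : q ^+ 2 * (h * h) = 1 by rewrite expr2 mulrACA qh mulr1.
  by rewrite q2; lra.
exists (q * d), (mx2 h (- h) h h), 0; split; first exact: mulr_gt0.
  apply/matrixP => i j; rewrite !mxE !big_ord_recl big_ord0 !mxE /=.
  by case: i => [[|[|i]] hi] //=; case: j => [[|[|j]] hj] //=; lra.
have TE y : (q * d) *: (mx2 h (- h) h h *m y) + 0 =
    pt (d * (y 0 0 - y 1 0)) (d * (y 0 0 + y 1 0)).
  rewrite addr0 {1}[y]ptE mx2_mul ptZ mulrAC.
  by congr pt; rewrite -[RHS]mul1r -qh; ring.
apply/seteqP; split=> [x|_ [y ys <-]].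
  rewrite [x]ptE => /out[_ _].
  move: (x 0 0) (x 1 0) => {}x y xy.
  exists (pt ((x + y) / (2 * d)) ((y - x) / (2 * d))); last first.
    by rewrite TE !mxE /=; congr pt; field; rewrite gt_eqF.
  move=> i; rewrite mxE; case: ifP => _; rewrite normrM normfV;
    rewrite (@gtr0_norm _ (2 * d)) ?mulr_gt0// ler_pdivrMr ?mulr_gt0// mul1r.
    exact: le_trans (ler_normD _ _) xy.
  by rewrite addrC in xy; apply: le_trans (ler_normB _ _) xy.
rewrite TE; move: (ys 0) (ys 1).
move: (y 0 0) (y 1 0) => {ys}y z hy hz.
have bnd : `|y - z| + `|y + z| <= 2 by rewrite -[2]mulr1 normB_normD_le.
have dd : 2 * d * d = d * (d * 2) by ring.
have e' : 2 * d - d = d by ring.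
by apply: inn; rewrite e e' dd -mulrDr !normrM gtr0_norm// -mulrDr !ler_pM2l//
  addrC.
Qed.

(** * The rotation by 45 degrees and gauges *)

Lemma cos_sin_pi4 (R : realType) :
  cos (pi / 4) = (Num.sqrt 2)^-1 :> R /\ sin (pi / 4) = (Num.sqrt 2)^-1 :> R.
Proof.
have pi0 := pi_gt0 R.
have cp : 0 < cos (pi / 4 : R) by apply: cos_gt0_pihalf; lra.
have cs : sin (pi / 4) = cos (pi / 4 : R).
  have c0 : cos (pi / 4 + pi / 4 : R) = 0.
    by rewrite (_ : pi / 4 + pi / 4 = pi / 2) ?cos_pihalf//; lra.
  have sp : 0 < sin (pi / 4 : R) by apply: sin_gt0_pi; lra.
  rewrite cosD in c0; nra.
suff c : cos (pi / 4) = (Num.sqrt 2)^-1 :> R by rewrite cs.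
have c2 : cos (pi / 4 : R) ^+ 2 = 2^-1.
  by have := cos2Dsin2 (pi / 4 : R); rewrite cs; lra.
by rewrite -sqrtrV// -c2 sqrtr_sqr gtr0_norm.
Qed.

Lemma rot45_pt (R : realType) (a b : R) :
  rot45 (pt a b) = (Num.sqrt 2)^-1 *: pt (a - b) (a + b).
Proof.
have [c s] := cos_sin_pi4 R.
have -> : rot45 (pt a b) = mx2 (Num.sqrt 2)^-1 (- (Num.sqrt 2)^-1)
    (Num.sqrt 2)^-1 (Num.sqrt 2)^-1 *m pt a b.
  rewrite /rot45; congr (_ *m _); apply/matrixP => i j; rewrite !mxE.
  by case: i => [[|[|i]] hi] //=; case: j => [[|[|j]] hj] //=; rewrite ?c ?s.
by rewrite mx2_mul ptZ; congr pt; ring.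
Qed.

Lemma gauge_le (R : realType) (n : nat) (K : set 'cV[R]_n) (x : 'cV[R]_n)
    (t : R) : 0 < t -> [set t *: y | y in K] x -> gauge K x <= t.
Proof.
by move=> t0 Kx; apply: ge_inf => //; exists 0 => r [r0 _]; exact: ltW.
Qed.

Lemma gauge_ge0 (R : realType) (n : nat) (K : set 'cV[R]_n) (x : 'cV[R]_n) :
  0 <= gauge K x.
Proof.
rewrite /gauge; set A := [set t | _].
have [->|/set0P A0] := eqVneq A set0; first by rewrite inf0.
by apply: lb_le_inf => // r [r0 _]; exact: ltW.
Qed.

(** The point [t0] shows that the infimum defining the gauge is over a
    nonempty set; otherwise it would have the default value 0. *)
Lemma gauge_lt (R : realType) (n : nat) (K : set 'cV[R]_n) (x : 'cV[R]_n)
    (m t0 : R) : 0 < t0 -> [set t0 *: y | y in K] x -> gauge K x < m ->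
  exists2 t, 0 < t < m & [set t *: y | y in K] x.
Proof.
move=> t00 Kx gm; have [|t [tp Kt] tm] := inf_lt _ gm; first by exists t0.
by exists t => //; rewrite tp.
Qed.

(** Both gauges are raised by the same [e], small enough to keep the product
    below [m]; admissible scalars are then found below the raised values. *)
Lemma gauge_mul_lt (R : realType) (n : nat) (K L : set 'cV[R]_n)
    (x : 'cV[R]_n) (m t s : R) :
  0 < t -> [set t *: y | y in K] x -> 0 < s -> [set s *: y | y in L] x ->
  gauge K x * gauge L x < m ->
  exists t' s', [/\ 0 < t', [set t' *: y | y in K] x, 0 < s',
    [set s' *: y | y in L] x & t' * s' < m].
Proof.
move=> t0 Kx s0 Lx gm.
have g1 := gauge_ge0 R n K x; have g2 := gauge_ge0 R n L x.
set a := gauge K x in gm g1 *; set b := gauge L x in gm g2 *.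
have c0 : 0 < a + b + 1 by lra.
(* [e <= 1] gives [(a + e) * (b + e) <= a * b + e * (a + b + 1)]. *)
pose e := Num.min 1 ((m - a * b) / (a + b + 1)).
have e0 : 0 < e by rewrite lt_min ltr01 divr_gt0// subr_gt0.
have e1 : e <= 1 by rewrite ge_min lexx.
have e2 : e * (a + b + 1) <= m - a * b.
  by rewrite -ler_pdivlMr// ge_min lexx orbT.
have [|t' /andP[t'0 t'a] Kt'] := gauge_lt R n K x (a + e) t t0 Kx.
  by rewrite ltrDl.
have [|s' /andP[s'0 s'b] Ls'] := gauge_lt R n L x (b + e) s s0 Lx.
  by rewrite ltrDl.
exists t', s'; split => //.
apply: (@lt_le_trans _ _ ((a + e) * (b + e))).
  by apply: ltr_pM => //; exact: ltW.
have : e * e <= e by rewrite ger_pMl.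
by nra.
Qed.

Lemma symmetric_body_absorbing (R : realType) (K : set 'cV[R]_2)
    (x : 'cV[R]_2) : convex_body K -> one_symmetric K ->
  exists2 t, 0 < t & [set t *: y | y in K] x.
Proof.
move=> bK sK.
have [s [d [d0 ds sd _ inn]]] := between_octagons_exists R K bK sK.
exists ((`|x 0 0| + `|x 1 0|) / d + 1).
  by rewrite ltr_wpDl// divr_ge0 ?addr_ge0// ltW.
set t := _ + 1.
have t0 : 0 < t by rewrite /t ltr_wpDl// divr_ge0 ?addr_ge0// ltW.
have td : `|x 0 0| + `|x 1 0| <= t * d.
  by rewrite /t mulrDl divfK ?gt_eqF//; lra.
exists (t^-1 *: x); last by rewrite scalerA divff ?scale1r// gt_eqF.
rewrite [x]ptE ptZ; move: (x 0 0) (x 1 0) td => a b td.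
have [ha hb] : 0 <= `|a| /\ 0 <= `|b| by [].
by apply: inn; rewrite !normrM gtr0_norm ?invr_gt0//
   mulrCA (mulrCA (s - d)) -mulrDr ler_pdivrMl//; nra.
Qed.

(** A multiple of the vector [(a + b, b - a)], which [rot45] turns towards
    [(a, b)], lies in the polar because [K] is bounded. *)
Lemma rot45_polar_absorbing (R : realType) (K : set 'cV[R]_2)
    (x : 'cV[R]_2) : convex_body K -> one_symmetric K ->
  exists2 t, 0 < t & [set t *: y | y in [set rot45 z | z in polar K]] x.
Proof.
move=> bK sK.
have [s [d [d0 ds sd out _]]] := between_octagons_exists R K bK sK.
have q0 : 0 < Num.sqrt 2 :> R by rewrite sqrtr_gt0.
have s0 : 0 < s by lra.
pose u := `|x 0 0 + x 1 0| + `|x 1 0 - x 0 0|.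
have u0 : 0 <= u by rewrite addr_ge0.
pose r := u * s + 1.
have r0 : 0 < r by rewrite ltr_wpDl// mulr_ge0// ltW.
exists (r / Num.sqrt 2); first by rewrite divr_gt0.
exists (rot45 (r^-1 *: pt (x 0 0 + x 1 0) (x 1 0 - x 0 0))).
  exists (r^-1 *: pt (x 0 0 + x 1 0) (x 1 0 - x 0 0)) => // y.
  rewrite [y]ptE ptZ dotv_pt => /out[]; move: (y 0 0) (y 1 0) => a b ha hb _.
  rewrite mulrCA (mulrCA b) -mulrDr ler_pdivrMl// mulr1.
  apply: (@le_trans _ _ (u * s)); last by rewrite lerDl.
  rewrite /u mulrDl; apply: lerD; apply: le_trans (ler_norm _) _;
  by rewrite normrM mulrC ler_wpM2l.
have q2 : Num.sqrt 2 ^+ 2 = 2 :> R by rewrite sqr_sqrtr.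
have rn : r != 0 by rewrite gt_eqF.
have qn : Num.sqrt 2 != 0 :> R by rewrite gt_eqF.
rewrite [RHS]ptE ptZ rot45_pt !ptZ; move: (Num.sqrt 2) q2 qn => q q2 qn.
by congr pt; apply: (mulfI (expf_neq0 2 qn)); rewrite [in RHS]q2; field;
  rewrite rn qn.
Qed.

(** * The distance to a square *)

(** If [x] violates the condition, a multiple of the square with vertices
    [+-x], [+-J x] lies between [K] and a multiple of [K] by less than [sqrt
    2]. *)
Lemma banach_mazur_square_lt (R : realType) (K L : set 'cV[R]_2) :
  convex_body K -> one_symmetric K -> is_square L ->
  ~ rotated_polar_condition K -> (banach_mazur K L < (Num.sqrt 2)%:E)%E.
Proof.
move=> bK sK [r [U [v [r0 UU ->]]]] /existsNP[x /negP].
rewrite -ltNge => gx.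
have [tK tK0 KtK] := symmetric_body_absorbing R K x bK sK.
have [tP tP0 PtP] := rot45_polar_absorbing R K x bK sK.
have [t [s [t0 Kx s0 Px ts]]] :=
  gauge_mul_lt R 2 _ _ x _ _ _ tK0 KtK tP0 PtP gx.
move: ts Kx Px => {tK tK0 KtK tP tP0 PtP gx}.
rewrite [x]ptE; move: (x 0 0) (x 1 0) => a b {x}.
rewrite enorm_pt_sqr; set N := a ^+ 2 + b ^+ 2 => ts [y Ky ey] [_ [w Pw <-] ew].
have q0 : 0 < Num.sqrt 2 :> R by rewrite sqrtr_gt0.
have q2 : Num.sqrt 2 ^+ 2 = 2 :> R by rewrite sqr_sqrtr.
rewrite [y]ptE ptZ in ey; rewrite [w]ptE rot45_pt !ptZ in ew.
rewrite [y]ptE in Ky; rewrite [w]ptE in Pw.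
move: (y 0 0) (y 1 0) (w 0 0) (w 1 0) Ky Pw ey ew => y1 y2 w1 w2 {y w} Ky Pw.
move=> /pt_inj[ea eb] /pt_inj[fa fb].
move: (Num.sqrt 2) q0 q2 fa fb => q q0 q2 fa fb.
have N0 : 0 < N by apply: lt_trans ts; exact: mulr_gt0.
have qn : q != 0 by rewrite gt_eqF.
have sn : s != 0 by rewrite gt_eqF.
have Nn : N != 0 by rewrite gt_eqF.
have qV : q^-1 = q / 2 by rewrite -q2; field.
have w1E : a + b = q * s * w1 by rewrite -fa -fb qV; field.
have w2E : b - a = q * s * w2 by rewrite -fa -fb qV; field.
have polK p1 p2 : K (pt p1 p2) -> (a + b) * p1 + (b - a) * p2 <= q * s.
  move=> Kp; have := Pw _ Kp; rewrite dotv_pt w1E w2E.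
  have -> : q * s * w1 * p1 + q * s * w2 * p2 = q * s * (p1 * w1 + p2 * w2).
    by ring.
  by move=> ?; rewrite ger_pMr// mulr_gt0.
have KN p1 p2 : K (pt p1 p2) -> K (pt (- p1) (- p2)).
  by rewrite -ptN; exact: one_symmetricN.
(* The matrix maps [(z1, z2)] to [(z1 + z2) *: (a, b) + (z1 - z2) *: (b, -
   a)], so it takes the square [[-1, 1]^2] to twice the square with vertices
   [+-x], [+-J x]; at scale [c] the image contains [K] by the bound [polK]. *)
pose c := q * s / (2 * N).
have c0 : 0 < c by rewrite divr_gt0 ?mulr_gt0.
have uM : mx2 (a + b) (a - b) (b - a) (a + b) \in unitmx.
  rewrite det_mx2_neq0 (_ : _ - _ = 2 * N) ?mulf_neq0 ?pnatr_eq0//.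
  by rewrite /N; ring.
have [uU uUT] := mulmx1_unit UU.
have rU z : (r^-1 *: U^T) *m (r *: (U *m z)) = z.
  by rewrite -scalemxAl -scalemxAr scalerA mulVf ?gt_eqF// scale1r mulmxA UU
    mul1mx.
pose M := mx2 (a + b) (a - b) (b - a) (a + b).
have TE z : c *: (M *m (r^-1 *: U^T)) *m (r *: (U *m z) + v + - v) =
    c *: (M *m z).
  by rewrite addrK -scalemxAl -mulmxA rU.
apply: (@le_lt_trans _ _ (q * s * t / N)%:E); last first.
  by rewrite lte_fin ltr_pdivrMr// -mulrA ltr_pM2l//; lra.
apply: (banach_mazur_le _ _ _ _ (c *: (M *m (r^-1 *: U^T))) (- v)).
- by rewrite divr_gt0 ?mulr_gt0.
- by rewrite unitmxZ ?unitfE ?gt_eqF// unitmx_mul uM unitmxZ// unitfE invr_eq0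
    gt_eqF.
- move=> x; rewrite [x]ptE; move: (x 0 0) (x 1 0) => p1 p2 Kp {x}.
  pose z := pt (((a + b) * p1 + (b - a) * p2) / (q * s))
               (((a - b) * p1 + (a + b) * p2) / (q * s)).
  exists (r *: (U *m z) + v); last first.
    rewrite TE mx2_mul ptZ /c /N; congr pt; field; rewrite qn sn /=.
      exact: Nn.
    exact: Nn.
  exists z => // i; rewrite mxE ler_norml.
  have f : K (pt p2 (- p1)).
    by apply: one_symmetric_flipr => //; exact: one_symmetric_swap.
  have g1 := polK _ _ Kp; have g2 := polK _ _ (KN _ _ Kp).
  have g3 := polK _ _ f; have g4 := polK _ _ (KN _ _ f).
  have qs0 : 0 < q * s by exact: mulr_gt0.
  by case: ifP => _; rewrite ler_pdivlMr// ler_pdivrMr//; lra.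
- move=> _ [z zs <-]; rewrite TE [z]ptE mx2_mul ptZ.
  have := zs 0; have := zs 1; move: (z 0 0) (z 1 0) => {zs} z1 z2 h2 h1.
  exists (((z1 + z2) / 2) *: pt y1 y2 + ((z1 - z2) / 2) *: pt y2 (- y1)).
    apply: symmetric_body_comb => //.
      by apply: one_symmetric_flipr => //; exact: one_symmetric_swap.
    have := normB_normD_le R z1 z2 1 h1 h2.
    by rewrite !normrM (@ger0_norm _ 2^-1) ?invr_ge0//; lra.
  rewrite !ptZ ptD ptZ /c /M -ea -eb; congr pt; field; exact: Nn.
Qed.

(** The case of a square: [(a, b)] is a vertex of a square inside [rho K], and
    the last hypothesis says that [(a + b, b - a) / D], which [rot45] sends to
    a multiple of [(a, b)], is in the polar of [K]. *)
Lemma conformal_square_ge (R : realType) (K : set 'cV[R]_2)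
    (a b rho D : R) :
  one_symmetric K -> rotated_polar_condition K -> 0 < rho ->
  0 < D -> D <= a ^+ 2 + b ^+ 2 ->
  [set rho *: x | x in K] (pt a b) ->
  (forall p1 p2, K (pt p1 p2) -> (a + b) * p1 + (b - a) * p2 <= D) ->
  Num.sqrt 2 <= rho.
Proof.
move=> sK /(_ (pt a b)); rewrite enorm_pt_sqr => gK rho0 D0.
set N := a ^+ 2 + b ^+ 2 in gK * => DN Kab polK.
have N0 : 0 < N by lra.
have q0 : 0 < Num.sqrt 2 :> R by rewrite sqrtr_gt0.
have q2 : Num.sqrt 2 ^+ 2 = 2 :> R by rewrite sqr_sqrtr.
have g1 := gauge_le R 2 K _ _ rho0 Kab.
have Nq0 : 0 < N / Num.sqrt 2 by rewrite divr_gt0.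
have g2 : gauge [set rot45 y | y in polar K] (pt a b) <= N / Num.sqrt 2.
  apply: gauge_le => //; exists (rot45 (pt ((a + b) / N) ((b - a) / N))).
    exists (pt ((a + b) / N) ((b - a) / N)) => // y; rewrite [y]ptE dotv_pt.
    move=> /polK h; rewrite -(ler_pM2r N0) mul1r mulrDl.
    by rewrite !mulrA !divfK ?gt_eqF//; lra.
  have Nn : N != 0 by rewrite gt_eqF.
  have qn : Num.sqrt 2 != 0 :> R by rewrite gt_eqF.
  rewrite rot45_pt !ptZ; move: (Num.sqrt 2) q2 qn => q q2 qn.
  by congr pt; apply: (mulfI (expf_neq0 2 qn)); rewrite [in RHS]q2; field;
    rewrite qn Nn.
have : N <= rho * (N / Num.sqrt 2).
  by apply: le_trans gK _; apply: ler_pM => //; exact: gauge_ge0.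
by rewrite mulrA ler_pdivlMr// mulrC ler_pM2r.
Qed.

(** With [v1 = (a, c)] and [v2 = (b, e)] the columns of the matrix [M], its
    conformal part has first column [alpha = (v1 - J v2) / 2], and the
    inequality [det M <= |alpha|^2] is [0 <= (a - e)^2 + (b + c)^2]. A
    negative determinant is made positive by changing the sign of [v2]. *)
Lemma parallelogram_sandwich_ge (R : realType) (K : set 'cV[R]_2)
    (a b c e rho : R) :
  convex_body K -> one_symmetric K -> rotated_polar_condition K -> 0 < rho ->
  a * e - b * c != 0 ->
  (forall x, K x -> exists c1 c2, `|c1| + `|c2| <= 1 /\
     x = mx2 a b c e *m pt c1 c2) ->
  [set rho *: x | x in K] (pt a c) -> [set rho *: x | x in K] (pt b e) ->
  Num.sqrt 2 <= rho.
Proof.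
move=> bK sK gK rho0.
wlog D0 : b e / 0 < a * e - b * c.
  move=> wl Dn KM K1 K2.
  have [D0|D0] := ltP 0 (a * e - b * c); first exact: (wl b e).
  apply: (wl (- b) (- e)) => //.
  - by move: D0; rewrite le_eqVlt (negbTE Dn) /=; lra.
  - by rewrite (_ : _ - _ = - (a * e - b * c)) ?oppr_eq0//; ring.
  - move=> x /KM[c1 [c2 [h ->]]]; exists c1, (- c2); rewrite normrN.
    by split=> //; rewrite !mx2_mul; congr pt; ring.
  - case: K2 => x Kx xe; exists (- x); first exact: one_symmetricN.
    by rewrite scalerN xe ptN.
move=> Dn KM [x1 Kx1 e1] [x2 Kx2 e2].
apply: (conformal_square_ge R K ((a + e) / 2) ((c - b) / 2) rho
  (a * e - b * c)) => //.
- by rewrite -subr_ge0 (_ : _ - _ = ((a - e) / 2) ^+ 2 + ((b + c) / 2) ^+ 2);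
    [rewrite addr_ge0 ?sqr_ge0|field].
- rewrite [x1]ptE ptZ in e1; rewrite [x2]ptE ptZ in e2.
  rewrite [x1]ptE in Kx1; rewrite [x2]ptE in Kx2.
  have [ea ec] := pt_inj _ _ _ _ _ e1; have [eb ee] := pt_inj _ _ _ _ _ e2.
  have K2' : K (pt (x2 1 0) (- x2 0 0)).
    by apply: one_symmetric_flipr => //; exact: one_symmetric_swap.
  exists (2^-1 *: (pt (x1 0 0) (x1 1 0) + pt (x2 1 0) (- x2 0 0))).
    exact: convex_body_mid.
  by rewrite ptD !ptZ; congr pt; rewrite -?ea -?eb -?ec -?ee; field.
move=> p1 p2 Kp.
have [c1 [c2 [h1]]] := KM _ Kp; rewrite mx2_mul => /pt_inj[E1 E2].
have [c3 [c4 [h2]]] := KM _ (one_symmetric_rot90 _ _ _ _ sK Kp).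
rewrite mx2_mul => /pt_inj[E3 E4].
(* Cramer's rule for the coordinates of [p] and of [J p] in the columns. *)
have F1 : (a * e - b * c) * c1 = e * p1 - b * p2 by rewrite E1 E2; ring.
have F2 : (a * e - b * c) * c2 = a * p2 - c * p1 by rewrite E1 E2; ring.
have p2E : p2 = - (a * c3 + b * c4) by rewrite -E3 opprK.
have F3 : (a * e - b * c) * c3 = - e * p2 - b * p1 by rewrite p2E E4; ring.
have F4 : (a * e - b * c) * c4 = a * p1 + c * p2 by rewrite p2E E4; ring.
have -> : ((a + e) / 2 + (c - b) / 2) * p1 + ((c - b) / 2 - (a + e) / 2) * p2 =
  (a * e - b * c) * ((c1 - c2 + c3 + c4) / 2).
  have -> : (a * e - b * c) * ((c1 - c2 + c3 + c4) / 2) =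
    ((a * e - b * c) * c1 - (a * e - b * c) * c2 + (a * e - b * c) * c3 +
     (a * e - b * c) * c4) / 2 by ring.
  by rewrite F1 F2 F3 F4; field.
rewrite ger_pMr//; have := ler_norm c1; have := ler_norm (- c2).
by rewrite normrN; have := ler_norm c3; have := ler_norm c4; lra.
Qed.

(** Subtracting the inclusions at [x] and [-x] removes the translations, since
    [K] and the square are centrally symmetric. The coordinates are then
    changed from the square [[-1, 1]^2] to [B_1], so that the columns of the
    matrix are vertices of the parallelogram. *)
Lemma banach_mazur_square_ge (R : realType) (K L : set 'cV[R]_2) :
  convex_body K -> one_symmetric K -> is_square L ->
  rotated_polar_condition K -> ((Num.sqrt 2)%:E <= banach_mazur K L)%E.
Proof.
move=> bK sK [r [U [w [r0 UU ->]]]] gK.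
apply: le_ereal_inf_tmp => _ [rho [rho0 [T [u [v [uT KL LK]]]]] <-].
rewrite lee_fin.
set A := r *: (T *m U); pose m0 := T *m (w + v).
have AE y : T *m (r *: (U *m y) + w + v) = A *m y + m0.
  by rewrite -addrA mulmxDr -scalemxAr mulmxA scalemxAl.
have AS (y : 'cV[R]_2) : (forall i, `|y i 0| <= 1) ->
    [set T *m z | z in translate [set r *: (U *m z) + w | z in
      [set z : 'cV[R]_2 | forall i, `|z i 0| <= 1]] v] (A *m y + m0).
  move=> yS; exists (r *: (U *m y) + w + v); last exact: AE.
  by exists (r *: (U *m y) + w) => //; exists y.
have KA x : K x -> exists2 y : 'cV[R]_2, (forall i, `|y i 0| <= 1) & x = A *m y.
  move=> Kx.
  have [|_ [_ [y yS <-] <-] e] := KL (x + u); first by exists x.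
  have [|_ [_ [y' yS' <-] <-] e'] := KL (- x + u).
    by exists (- x) => //; exact: one_symmetricN.
  rewrite !AE in e e'.
  exists (2^-1 *: (y - y')).
    move=> i; rewrite !mxE; have := yS i; have := yS' i.
    rewrite !ler_norml => /andP[? ?] /andP[? ?]; lra.
  rewrite -scalemxAr mulmxBr -[A *m y](addrK m0) -[A *m y'](addrK m0) e e'.
  by apply/matrixP => i j; rewrite !mxE; lra.
have AK (y : 'cV[R]_2) : (forall i, `|y i 0| <= 1) ->
    [set rho *: x | x in K] (A *m y).
  move=> yS.
  have [_ [k Kk <-]] := LK _ (AS _ yS).
  have [|_ [k' Kk' <-]] := LK (A *m (- y) + m0).
    by apply: AS => i; rewrite mxE normrN.
  rewrite mulmxN; move: (A *m y) => Y e' e.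
  exists (2^-1 *: (k + - k')).
    by apply: convex_body_mid => //; exact: one_symmetricN.
  apply/matrixP => i j.
  have := congr1 (fun X : 'cV_2 => X i j) e.
  have := congr1 (fun X : 'cV_2 => X i j) e'.
  by rewrite !mxE; lra.
pose M := A *m mx2 1 (-1) 1 1.
have uM : M \in unitmx.
  have [_ uU] := mulmx1_unit UU.
  rewrite unitmx_mul /A unitmxZ ?unitfE ?gt_eqF// unitmx_mul uT uU /=.
  by rewrite det_mx2_neq0 mulN1r opprK mulr1 (_ : 1 + 1 = 2%:R) ?pnatr_eq0.
have KM x : K x -> exists c1 c2, `|c1| + `|c2| <= 1 /\ x = M *m pt c1 c2.
  move=> /KA[y yS ->].
  exists ((y 0 0 + y 1 0) / 2), ((y 1 0 - y 0 0) / 2); split.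
    have := normB_normD_le R _ _ _ (yS 1) (yS 0).
    by rewrite (addrC (y 0 0)) !normrM (@ger0_norm _ 2^-1) ?invr_ge0//; lra.
  rewrite -mulmxA mx2_mul {1}[y]ptE; congr (_ *m pt _ _); lra.
have MK c1 c2 : `|c1 - c2| <= 1 -> `|c1 + c2| <= 1 ->
    [set rho *: x | x in K] (M *m pt c1 c2).
  move=> h1 h2; rewrite -mulmxA mx2_mul; apply: AK => i; rewrite mxE.
  by case: ifP => _; rewrite ?mulN1r !mul1r.
have M1 := MK 1 0; have M2 := MK 0 1.
move: uM KM M1 M2; rewrite [M]mx2E det_mx2_neq0 !mx2_mul.
rewrite !mulr1 !mulr0 !addr0 !add0r subr0 normrN normr1 => D KM M1 M2.
exact: parallelogram_sandwich_ge bK sK gK rho0 D KM (M1 _ _) (M2 _ _).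
Qed.

Theorem theorem1p4 (R : realType) (K L : set 'cV[R]_2)
    (Kbody : convex_body K) (Ksym : one_symmetric K)
    (Lbody : convex_body L) (Lsym : one_symmetric L) :
  (banach_mazur K L <= (Num.sqrt 2)%:E)%E /\
  (banach_mazur K L = (Num.sqrt 2)%:E <->
     (is_square L /\ rotated_polar_condition K) \/
     (is_square K /\ rotated_polar_condition L)).
Proof.
have [s [d oK]] := between_octagons_exists R K Kbody Ksym.
have [s' [d' oL]] := between_octagons_exists R L Lbody Lsym.
have [rho [KLrho rhoq rholt]] := banach_mazur_octagons_le R K L s d s' d' oK oL.
have le : (banach_mazur K L <= (Num.sqrt 2)%:E)%E.
  by apply: le_trans KLrho _; rewrite lee_fin.
split=> //; split; last first.
  move=> [] [sq cond]; apply/eqP; rewrite eq_le le /=;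
    last rewrite banach_mazurC.
    exact: banach_mazur_square_ge.
  exact: banach_mazur_square_ge.
move=> e.
have [hL|/(between_octagons_square R L _ _ oL) sqL] :=
    boolP (d' < s' < 2 * d').
  have [hK|/(between_octagons_square R K _ _ oK) sqK] := boolP (d < s < 2 * d).
    by have := rholt hK hL; rewrite ltNge -lee_fin -e KLrho.
  right; split=> //; apply: contrapT => nc.
  have := banach_mazur_square_lt R L K Lbody Lsym sqK nc.
  by rewrite banach_mazurC e ltxx.
left; split=> //; apply: contrapT => nc.
have := banach_mazur_square_lt R K L Kbody Ksym sqL nc.
by rewrite e ltxx.
Qed.
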